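(* Let $K$ be a Jacobson ring. Then every $\pi$-algebraic $K$-algebra is nil. That is: if $R$ is a $K$-algebra such that for every $a\in R$ there exists a polynomial $p\in K[x]$ with $p(0)=0$, $p(1)=1$ and $p(a)=0$, then every element of $R$ is nilpotent.
   Context: Algebras are associative, possibly nonunital and noncommutative. A Jacobson ring (Hilbert ring) is a commutative unital ring $K$ in which every prime ideal is an intersection of maximal ideals. An element $a$ of a $K$-algebra $R$ is $\pi$-algebraic (over $K$) if there is a polynomial $p\in K[x]$ with $p(0)=0$, $p(1)=1$ and $p(a)=0$; $R$ is $\pi$-algebraic if all its elements are. $R$ is nil if every element of $R$ is nilpotent. *)

(* Defs.v *)
From HB Require Import structures.
From mathcomp Require Import all_boot all_order all_algebra.

Set Implicit Arguments.
Unset Strict Implicit.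
Unset Printing Implicit Defensive.

Import GRing.Theory.
Local Open Scope ring_scope.

(* Ideals are boolean predicates, as in [ring_quotient]; classically every
   subset is of this form.  [idealr_closed] includes properness (1 \notin S). *)

Definition prime_ideal (K : comNzRingType) (P : {pred K}) : Prop :=
  idealr_closed P /\ prime_idealr_closed P.

Definition maximal_ideal (K : comNzRingType) (M : {pred K}) : Prop :=
  idealr_closed M /\
  forall J : {pred K}, idealr_closed J -> {subset M <= J} -> J =i M.

Definition jacobson_ring (K : comNzRingType) : Prop :=
  forall P : {pred K}, prime_ideal P ->
  exists2 F : {pred K} -> Prop,
    forall M : {pred K}, F M -> maximal_ideal M
    & forall x : K, x \in P <-> (forall M : {pred K}, F M -> x \in M).

(* MathComp rings have a unit, so a possibly nonunital associative algebra is
   a module with an associative bilinear product. *)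
HB.mixin Record Lmodule_isNonunitalAlgebra (K : comNzRingType) R
    of GRing.Lmodule K R := {
  numul : R -> R -> R;
  numulA : associative numul;
  numulDl : left_distributive numul +%R;
  numulDr : right_distributive numul +%R;
  nuscaleAl : forall (k : K) (a b : R), k *: numul a b = numul (k *: a) b;
  nuscaleAr : forall (k : K) (a b : R), k *: numul a b = numul a (k *: b)
}.

#[short(type="nonunitalAlgType")]
HB.structure Definition NonunitalAlgebra (K : comNzRingType) :=
  {R of GRing.Lmodule K R & Lmodule_isNonunitalAlgebra K R}.

(* With no unit there is no power a ^ 0: [nuexpS a n] is a ^ (n + 1). *)
Definition nuexpS (K : comNzRingType) (R : nonunitalAlgType K) (a : R)
    (n : nat) : R :=
  iter n (numul a) a.

(* p(a) for p(0) = 0; the constant coefficient of p is ignored. *)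
Definition nueval (K : comNzRingType) (R : nonunitalAlgType K) (p : {poly K})
    (a : R) : R :=
  \sum_(i < (size p).-1) p`_i.+1 *: nuexpS a i.

Definition pi_algebraic_elt (K : comNzRingType) (R : nonunitalAlgType K)
    (a : R) : Prop :=
  exists p : {poly K}, [/\ p.[0] = 0, p.[1] = 1 & nueval p a = 0].

Definition pi_algebraic (K : comNzRingType) (R : nonunitalAlgType K) : Prop :=
  forall a : R, pi_algebraic_elt a.

Definition nilpotent_elt (K : comNzRingType) (R : nonunitalAlgType K)
    (a : R) : Prop :=
  exists n : nat, nuexpS a n = 0.

Definition nil_algebra (K : comNzRingType) (R : nonunitalAlgType K) : Prop :=
  forall a : R, nilpotent_elt a.

(* Main.v *)
(* Suppose [a] is not nilpotent.  The annihilator of [a] in K[x] contains no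
   power of [x], so it lies in a prime ideal Q with x \notin Q; let P be the
   contraction of Q to K.  For every f \in xK[x] the
   hypothesis on f(a) gives p with p(0) = 0, p(1) = 1 and p(f) \in Q.
   If Q contains some c + x g with c \notin P, choose a maximal ideal M of K
   containing P but not c, and k with k c = 1 mod M; for f = - k x g one has
   f = k c mod Q, so p(k c) \in P and 1 = p(1) = p(k c) = 0 mod M.
   Otherwise, cancelling x repeatedly, Q = P[x]; then f = x gives p \in P[x],
   so 1 = p(1) \in P. *)

Require Import Defs.
From HB Require Import structures.
From mathcomp Require Import all_boot all_order all_algebra.
From mathcomp Require Import boolp classical_sets.

Set Implicit Arguments.
Unset Strict Implicit.
Unset Printing Implicit Defensive.

Import GRing.Theory.
Local Open Scope ring_scope.

(** * Congruences modulo an ideal of a commutative ring *)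

Section Ideals.

Variables (T : comNzRingType) (J : {pred T}).
Hypothesis hJ : idealr_closed J.

Lemma idealr_closedMl x y : y \in J -> x * y \in J.
Proof. by case: hJ => J0 _ JD yJ; rewrite -[x * y]addr0 JD. Qed.

Lemma idealr_closedD x y : x \in J -> y \in J -> x + y \in J.
Proof. by case: hJ => _ _ JD xJ yJ; rewrite -[x]mul1r JD. Qed.

Lemma idealr_closed_sub x y : x \in J -> y \in J -> x - y \in J.
Proof. by move=> xJ yJ; rewrite idealr_closedD // -mulN1r idealr_closedMl. Qed.

Lemma idealr_closed_eqmod x y : x - y \in J -> (x \in J) = (y \in J).
Proof.
move=> xyJ; apply/idP/idP => [xJ | yJ].
  by rewrite -[y](subKr x) idealr_closed_sub.
by rewrite -[x](subrK y) idealr_closedD.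
Qed.

Lemma horner_eqmod (p : {poly T}) x y : x - y \in J -> p.[x] - p.[y] \in J.
Proof.
move=> xyJ; elim/poly_ind: p => [|p c IHp].
  by rewrite !horner0 subrr; case: hJ.
rewrite !hornerMXaddC opprD addrACA subrr addr0.
have -> : p.[x] * x - p.[y] * y = p.[x] * (x - y) + y * (p.[x] - p.[y]).
  by rewrite !mulrBr [y * _]mulrC [y * _]mulrC addrA subrK.
by rewrite idealr_closedD ?idealr_closedMl.
Qed.

(** Closure of [J + (u)] under [a * x + y], separated from properness because the Zorn argument
    below also uses it, where powers of [s] are avoided instead. *)
Lemma adjoin_closedD (u a x y t t' : T) :
  x - u * t \in J -> y - u * t' \in J ->
  a * x + y - u * (a * t + t') \in J.
Proof.
case: hJ => _ _ JD xt yt.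
rewrite mulrDr mulrCA opprD addrACA -mulrBr; exact: JD.
Qed.

Lemma adjoin_idealr_closed (u : T) :
  ~ (exists t, 1 - u * t \in J) ->
  idealr_closed [pred x | `[< exists t, x - u * t \in J >]].
Proof.
move=> J1; split=> [||a x y].
- by apply/asboolP; exists 0; rewrite mulr0 subrr; case: hJ.
- exact/asboolP.
move=> /asboolP [t xt] /asboolP [t' yt']; apply/asboolP.
exists (a * t + t'); exact: adjoin_closedD.
Qed.

End Ideals.

(* Krull: an ideal maximal among those disjoint from the powers of [s] is
   prime. *)
Lemma prime_ideal_avoiding (T : comNzRingType) (J : {pred T}) (s : T) :
  idealr_closed J ->
  (forall n, s ^+ n \notin J) ->
  exists2 Q : {pred T}, prime_ideal Q & {subset J <= Q} /\ s \notin Q.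
Proof.
move=> hJ sJ; have [J0 _ JD] := hJ.
(* The empty set is admitted because [Zorn_bigcup] includes the empty chain. *)
pose good (X : set T) := [/\ forall a u v, X u -> X v -> X (a * u + v),
  forall u v, X u -> v \in J -> X (u + v) & forall n, ~ X (s ^+ n)].
have [F goodF totF|A [[AD AJ As] Amax]] := @Zorn_bigcup T good.
  split=> [a u v [X FX Xu] [Y FY Yv]|u v [X FX Xu] vJ|n [X FX Xs]].
  - case: (totF X Y FX FY) => [XY|YX].
      exists Y => //; case: (goodF Y FY) => YD _ _.
      by apply: YD => //; apply: XY.
    exists X => //; case: (goodF X FX) => XD _ _.
    by apply: XD => //; apply: YX.
  - by exists X => //; case: (goodF X FX) => _ XJ _; apply: XJ.
  - by case: (goodF X FX) => _ _ /(_ n).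
(* If [A] misses 0 it is empty, since [-u + u = 0]; then [J] is a strictly larger good set. *)
have A0 : A 0.
  apply: contrapT => A0; have noA u : ~ A u.
    move=> Au; apply: A0; have := AD (-1) u u Au Au.
    by rewrite mulN1r addNr.
  apply: (Amax [set u | u \in J]%classic).
    split=> [u /noA //|JA]; exact: (noA 0 (JA 0 J0)).
  split=> [a u v uJ vJ|u v uJ vJ|n sn]; first exact: JD.
    exact: (idealr_closedD hJ).
  by move: (sJ n); rewrite sn.
pose Q : {pred T} := [pred u | `[< A u >]].
have QP u : reflect (A u) (u \in Q) by exact: asboolP.
have hQ : idealr_closed Q.
  split=> [||a u v /QP Au /QP Av]; apply/QP => //; last exact: AD.
  by rewrite -(expr0 s); apply: As.
have JQ : {subset J <= Q} by move=> u uJ; apply/QP; rewrite -[u]add0r; apply: AJ.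
(* Otherwise [Q + (u)] would be a good set strictly larger than [A]. *)
have powQ u : u \notin Q -> exists n t, s ^+ n - u * t \in Q.
  move=> uQ; apply: contrapT => noQ.
  apply: (Amax [set x | exists t, x - u * t \in Q]%classic).
    split=> [x Ax|QA]; first by exists 0; rewrite mulr0 subr0; apply/QP.
    case/negP: uQ; apply/QP/QA; exists 1; rewrite mulr1 subrr; exact/QP.
  split=> [a x y [t xt] [t' yt']|x y [t xt] yJ|n [t st]].
  - by exists (a * t + t'); apply: (adjoin_closedD hQ).
  - by exists t; rewrite addrAC; apply: (idealr_closedD hQ); last exact: JQ.
  - by apply: noQ; exists n, t.
exists Q; last by split=> //; apply/QP; rewrite -(expr1 s); apply: As.
split=> // u v uvQ; rewrite -[_ || _]negbK negb_or.
apply/negP => /andP [/powQ [m [t ut]] /powQ [n [t' vt']]].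
(* Multiplying the two congruences gives [s ^+ (m + n)] congruent to [u * v * (t * t')], which lies
   in [Q] with [u * v]. *)
suff /QP : s ^+ (m + n) \in Q by apply: As.
rewrite exprD (idealr_closed_eqmod hQ (y := u * v * (t * t'))).
  by rewrite mulrC (idealr_closedMl hQ).
have -> : s ^+ m * s ^+ n - u * v * (t * t') =
    s ^+ n * (s ^+ m - u * t) + u * t * (s ^+ n - v * t').
  rewrite !mulrBr [s ^+ n * (u * t)]mulrC addrA [s ^+ n * _]mulrC subrK.
  by rewrite mulrACA.
by rewrite (idealr_closedD hQ) ?(idealr_closedMl hQ).
Qed.

(** * The K[x]-module defined by an endomorphism *)

Section PolyAction.

Variables (K : comNzRingType) (V : lmodType K) (f : {linear V -> V}).

(** Here ['X] acts as [f]. In a nonunital algebra a polynomial with constant term has no value at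
    [a], but it does act on the module through left multiplication by [a]. *)
Definition poly_act (p : {poly K}) (v : V) : V :=
  \sum_(i < size p) p`_i *: iter i f v.

Lemma poly_act_widen n (p : {poly K}) v : (size p <= n)%N ->
  poly_act p v = \sum_(i < n) p`_i *: iter i f v.
Proof.
move=> le_pn; rewrite /poly_act (big_ord_widen n (fun i => p`_i *: iter i f v)) //.
rewrite big_mkcond; apply: eq_bigr => i _; case: ltnP => // le_pi.
by rewrite nth_default ?scale0r.
Qed.

Lemma poly_act0 v : poly_act 0 v = 0.
Proof. by rewrite /poly_act size_poly0 big_ord0. Qed.

Lemma poly_act1 v : poly_act 1 v = v.
Proof. by rewrite /poly_act size_poly1 big_ord1 coef1 scale1r. Qed.

Lemma poly_actD (p q : {poly K}) v : poly_act (p + q) v = poly_act p v + poly_act q v.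
Proof.
pose n := maxn (size p) (size q).
rewrite !(@poly_act_widen n) ?leq_maxl ?leq_maxr ?size_polyD //.
by rewrite -big_split; apply: eq_bigr => i _; rewrite coefD scalerDl.
Qed.

Lemma poly_actZ c (p : {poly K}) v : poly_act (c *: p) v = c *: poly_act p v.
Proof.
rewrite (@poly_act_widen (size p) (c *: p)) ?size_scale_leq // scaler_sumr.
by apply: eq_bigr => i _; rewrite coefZ scalerA.
Qed.

Lemma poly_actMX (p : {poly K}) v : poly_act (p * 'X) v = poly_act p (f v).
Proof.
have leS : (size (p * 'X)%R <= (size p).+1)%N.
  by apply: leq_trans (size_polyMleq _ _) _; rewrite size_polyX addn2.
rewrite (poly_act_widen _ leS) big_ord_recl coefMX scale0r add0r.
by apply: eq_bigr => i _; rewrite coefMX /= -iterS iterSr.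
Qed.

Lemma poly_act_sum I (r : seq I) (F : I -> {poly K}) v :
  poly_act (\sum_(i <- r) F i) v = \sum_(i <- r) poly_act (F i) v.
Proof.
by apply: (big_morph (poly_act^~ v)) => [p q|]; rewrite ?poly_actD ?poly_act0.
Qed.

Lemma poly_act_f p v : poly_act p (f v) = f (poly_act p v).
Proof.
rewrite /poly_act linear_sum; apply: eq_bigr => i _.
by rewrite linearZ -iterSr.
Qed.

Lemma poly_act_v0 p : poly_act p 0 = 0.
Proof.
elim/poly_ind: p => [|p c IHp]; first exact: poly_act0.
by rewrite poly_actD poly_actMX linear0 IHp -alg_polyC poly_actZ poly_act1
  scaler0 addr0.
Qed.

Lemma poly_actM p q v : poly_act (p * q) v = poly_act p (poly_act q v).
Proof.
elim/poly_ind: p v => [|p c IHp] v; first by rewrite mul0r !poly_act0.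
rewrite mulrDl -mulrA -commr_polyX mulrA !poly_actD !poly_actMX IHp poly_act_f.
by rewrite -alg_polyC -scalerAl mul1r !poly_actZ poly_act1.
Qed.

End PolyAction.

(** * Prime ideals of K[x] over a Jacobson ring *)

Section JacobsonPolynomials.

Variables (K : comNzRingType) (Q : {pred {poly K}}).
Hypothesis Q_prime : prime_ideal Q.

Lemma contraction_prime_ideal : prime_ideal [pred c : K | c%:P \in Q].
Proof.
case: Q_prime => [[Q0 Q1 QD] Qmul]; split.
  split; rewrite ?inE // => a u v; rewrite !inE polyCD polyCM; exact: QD.
by move=> u v; rewrite !inE polyCM; apply: Qmul.
Qed.

Lemma jacobson_exists_maximal (c : K) : jacobson_ring K -> c%:P \notin Q ->
  exists M : {pred K}, [/\ maximal_ideal M, c \notin M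
    & forall x, x%:P \in Q -> x \in M].
Proof.
move=> /(_ _ contraction_prime_ideal) [F Fmax QF] cQ.
have [M [FM cM]] : exists M, F M /\ c \notin M.
  apply: contrapT => noM; case/negP: cQ; apply/(QF c) => M FM.
  by apply: contraT => cM; case: noM; exists M.
exists M; split=> //; first exact: Fmax.
by move=> x /(QF x); apply.
Qed.

(** If [c] had no inverse modulo [M], then [M + (c)] would be a proper ideal containing [M], hence
    equal to [M]. *)
Lemma maximal_ideal_inv (M : {pred K}) (c : K) :
  maximal_ideal M -> c \notin M -> exists k, 1 - c * k \in M.
Proof.
move=> [hM Mmax] cM; apply: contrapT => noinv.
case/negP: cM; rewrite -(Mmax _ (adjoin_idealr_closed hM noinv)).
  by apply/asboolP; exists 1; rewrite mulr1 subrr; case: hM.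
by move=> x xM; apply/asboolP; exists 0; rewrite mulr0 subr0.
Qed.

Lemma jacobson_prime_contraction (c : K) (g : {poly K}) :
  jacobson_ring K ->
  (forall h : {poly K}, exists2 p : {poly K}, p.[1] = 1 & p \Po (h * 'X) \in Q) ->
  g * 'X + c%:P \in Q -> c%:P \in Q.
Proof.
move=> hK Qalg gcQ; have [hQ _] := Q_prime.
apply: contraT => /(jacobson_exists_maximal hK) [M [Mmax cM QM]].
have [k ckM] := maximal_ideal_inv Mmax cM; have [hM _] := Mmax.
(* Modulo [Q], [g * 'X] is [-c], so this choice of [h] makes [h * 'X] congruent to the constant
   [c * k]. *)
have [p p1 pQ] := Qalg (- k%:P * g).
have : p.[c * k] \in M.
  apply: QM; rewrite -comp_polyCr.
  rewrite -(idealr_closed_eqmod hQ (x := p \Po (- k%:P * g * 'X))) //.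
  (* Composition is by definition evaluation in [{poly K}], so it respects congruence modulo [Q]. *)
  apply: (horner_eqmod hQ).
  have -> : - k%:P * g * 'X - (c * k)%:P = - k%:P * (g * 'X + c%:P).
    by rewrite !mulNr -opprD mulrDr mulrA polyCM [c%:P * _]mulrC.
  exact: idealr_closedMl.
rewrite -(idealr_closed_eqmod hM (horner_eqmod hM p ckM)) p1.
by case: hM => _ /negPf ->.
Qed.

Lemma jacobson_prime_contains_X :
  jacobson_ring K ->
  (forall h : {poly K}, exists2 p : {poly K}, p.[1] = 1 & p \Po (h * 'X) \in Q) ->
  'X \in Q.
Proof.
move=> hK Qalg; apply: contraT => XQ; have [hQ Qmul] := Q_prime.
(* The constant coefficient is in [Q] by the previous lemma; what remains is a multiple of ['X],
   which primeness allows to cancel. *)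
have coefQ (q : {poly K}) : q \in Q -> forall i, (q`_i)%:P \in Q.
  elim/poly_ind: q => [|q c IHq] qQ i; first by rewrite coef0.
  have cQ := jacobson_prime_contraction hK Qalg qQ.
  rewrite coefD coefMX coefC; case: i => [|i] /=; first by rewrite add0r.
  rewrite addr0; apply: IHq; move: qQ.
  rewrite (idealr_closed_eqmod hQ (y := q * 'X)); last by rewrite addrC addKr.
  by move=> /Qmul; rewrite (negPf XQ) orbF.
have [p p1] := Qalg 1; rewrite mul1r comp_polyXr => /coefQ pQ.
have : p.[1]%:P \in Q.
  rewrite horner_coef rmorph_sum.
  apply: (big_ind (fun r => r \in Q)); first by case: hQ.
    exact: (idealr_closedD hQ).
  by move=> i _; rewrite /= expr1n mulr1.
by rewrite p1; case: hQ => _ /negPf ->.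
Qed.

End JacobsonPolynomials.

(** * The action of K[x] on a nonunital algebra *)

Section NonunitalEvaluation.

Variables (K : comNzRingType) (R : nonunitalAlgType K) (a : R).

Lemma numul_is_linear (b : R) : linear (@numul K R b).
Proof. by move=> k x y; rewrite numulDr nuscaleAr. Qed.

HB.instance Definition _ (b : R) :=
  GRing.isLinear.Build K R R *:%R (@numul K R b) (numul_is_linear b).

Lemma numul0r (b : R) : numul 0 b = 0.
Proof. by apply: (addrI (numul 0 b)); rewrite -numulDl !addr0. Qed.

Lemma poly_act_numul (p : {poly K}) (x y : R) :
  poly_act (numul a) p (numul x y) = numul (poly_act (numul a) p x) y.
Proof.
elim/poly_ind: p x => [|p c IHp] x; first by rewrite !poly_act0 numul0r.
rewrite !poly_actD !poly_actMX /= numulA IHp numulDl -alg_polyC !poly_actZ.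
by rewrite !poly_act1 nuscaleAl.
Qed.

Lemma poly_act_Xn n : poly_act (numul a) 'X^n a = nuexpS a n.
Proof.
elim: n => [|n IHn]; first by rewrite expr0 poly_act1.
by rewrite exprSr poly_actMX poly_act_f IHn.
Qed.

(** The element [b] is the value of [h * 'X] at [a], so the composite sends [a] to p(b)a. *)
Lemma poly_act_comp (p h : {poly K}) (b := poly_act (numul a) h a) :
  p.[0] = 0 -> nueval p b = 0 -> poly_act (numul a) (p \Po (h * 'X)) a = 0.
Proof.
move=> p0 pb; rewrite comp_polyE poly_act_sum.
(* By associativity [h * 'X] acts as left multiplication by [b]. *)
have iterE i : poly_act (numul a) ((h * 'X) ^+ i) a = iter i (numul b) a.
  elim: i => [|i IHi]; first by rewrite expr0 poly_act1.
  by rewrite exprS poly_actM IHi poly_actMX poly_act_numul.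
have iterS i : iter i.+1 (numul b) a = numul (nuexpS b i) a.
  by elim: i => //= i ->; rewrite numulA.
have mul_aD : {morph (@numul K R)^~ a : x y / x + y}.
  by move=> x y; apply: numulDl.
transitivity (numul (nueval p b) a); last by rewrite pb numul0r.
rewrite /nueval (big_morph _ mul_aD (numul0r a)).
case: (size p) => [|n]; first by rewrite !big_ord0.
(* [nueval] has no constant term; p(0) = 0 removes it on the other side, and the indices then
   match. *)
rewrite big_ord_recl -horner_coef0 p0 scale0r poly_act0 add0r.
by apply: eq_bigr => i _; rewrite poly_actZ iterE iterS nuscaleAl.
Qed.

Lemma annihilator_idealr_closed :
  a <> 0 -> idealr_closed [pred q : {poly K} | poly_act (numul a) q a == 0].
Proof.
move=> /eqP a0; split=> [||q u v]; rewrite !inE ?poly_act0 ?poly_act1 //.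
by move=> /eqP u0 /eqP v0; rewrite poly_actD poly_actM u0 v0 poly_act_v0 addr0.
Qed.

End NonunitalEvaluation.

Theorem theorem3p12 (K : comNzRingType) (R : nonunitalAlgType K)
    (hK : jacobson_ring K) (hR : pi_algebraic R) : nil_algebra R.
Proof.
move=> a; apply: contrapT => a_nonnil.
have /annihilator_idealr_closed hI : a <> 0.
  by move=> a0; apply: a_nonnil; exists 0%N.
have [n|Q Qprime [IQ]] := prime_ideal_avoiding hI (s := 'X).
  by apply/eqP; rewrite poly_act_Xn => an; apply: a_nonnil; exists n.
case/negP; apply: (jacobson_prime_contains_X Qprime hK) => h.
(* The hypothesis is applied to every h(a)a, not only to [a]; the composite then annihilates [a], so
   it lies in [Q]. *)
have [p [p0 p1 pb]] := hR (poly_act (numul a) h a); exists p => //.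
by apply: IQ; rewrite inE poly_act_comp.
Qed.
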